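(* Let $n>1$ be an integer, $\delta'>0$, $\lambda\in\mathbb{R}$ with $\lambda\neq0$, and let $u^{(0)},u^{(0)}_1\in\mathbb{R}$ with $u^{(0)}\neq0$. Then there exists $\delta^{(2)}>0$ such that there is a unique nowhere vanishing solution $u:(-\delta^{(2)},\delta^{(2)})\to\mathbb{R}$ of $$\frac{d}{dz}\left(\left(z^{2}-\delta'^{2}\right)\frac{d\,u^{n}(z)}{dz}\right)=\lambda u(z),\qquad u(0)=u^{(0)},\quad \frac{du}{dz}(0)=u_1^{(0)}.$$ Moreover $u$ is analytic, $u(z)=\sum_{i=0}^{\infty}a_i z^i$ on $(-\delta^{(2)},\delta^{(2)})$ with $a_i=\frac{1}{i!}\frac{d^iu}{dz^i}(0)$, and the coefficients satisfy, for all $i\ge 0$, $$a_{i+2}=-\frac{\lambda a_i}{\delta'^{2}(i+1)(i+2)n a_0^{n-1}}+\frac{1}{\delta'^{2}(i+2)n a_0^{n}}\left(\sum_{k=1}^{i}(k(n+1)-i)a_k b_{i-k}-\delta'^{2}\sum_{k=1}^{i+1}(k(n+1)-i-2)a_k b_{i+2-k}\right).$$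
   Context: Here $u^n$ is the $n$-th power of $u$. The numbers $b_j$ are defined from $(a_i)$ by $b_0=a_0^n$ and $b_j=\frac{1}{j a_0}\sum_{k=1}^{j}(k(n+1)-j)a_k b_{j-k}$ for $j>0$ (the coefficients of $\left(\sum_i a_i z^i\right)^n$). Empty sums are zero. *)

(* Defs.v *)
From Stdlib Require Import Reals Lra Lia Arith.
From Coquelicot Require Import Coquelicot.
Open Scope R_scope.

(* Course-of-values recursion: for j <= m, [power_coeff_upto a n m j] is the
   j-th coefficient b_j of (sum_i a_i z^i)^n. [sum_n_m f p q] is the sum of
   f k over p <= k <= q, and is 0 when q < p. *)
Fixpoint power_coeff_upto (a : nat -> R) (n m : nat) : nat -> R :=
  match m with
  | O => fun _ => a 0%nat ^ n
  | S m' => fun j =>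
      if Nat.eqb j m then
        1 / (INR j * a 0%nat) *
        sum_n_m (fun k => (INR k * (INR n + 1) - INR j) * a k *
                          power_coeff_upto a n m' (j - k)%nat) 1 j
      else power_coeff_upto a n m' j
  end.

Definition power_coeff (a : nat -> R) (n j : nat) : R :=
  power_coeff_upto a n j j.

Lemma power_coeff_upto_le (a : nat -> R) (n m j : nat) :
  (j <= m)%nat -> power_coeff_upto a n m j = power_coeff a n j.
Proof.
  induction m as [|m IH]; intros Hj.
  - now replace j with 0%nat by lia.
  - destruct (Nat.eq_dec j (S m)) as [->|Hne]; [reflexivity|].
    simpl; rewrite (proj2 (Nat.eqb_neq j (S m)) Hne).
    apply IH; lia.
Qed.

(* The two defining equations of b_j. *)
Lemma power_coeff_0 (a : nat -> R) (n : nat) :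
  power_coeff a n 0 = a 0%nat ^ n.
Proof. reflexivity. Qed.

Lemma power_coeff_pos (a : nat -> R) (n j : nat) : (0 < j)%nat ->
  power_coeff a n j =
  1 / (INR j * a 0%nat) *
  sum_n_m (fun k => (INR k * (INR n + 1) - INR j) * a k *
                    power_coeff a n (j - k)%nat) 1 j.
Proof.
  destruct j as [|j]; intros Hj; [lia|].
  unfold power_coeff at 1; cbn -[INR Nat.sub].
  rewrite Nat.eqb_refl; f_equal.
  apply sum_n_m_ext_loc; intros k Hk.
  rewrite power_coeff_upto_le by lia; reflexivity.
Qed.

(* [u] is a total function, but only its values on (-delta, delta) matter.
   Differentiability of [u] makes the inner [Derive] a genuine derivative;
   no second derivative of [u] is assumed beyond what the equation itself
   requires. *)
Record nowhere_vanishing_solution (n : nat) (delta' lambda u0 u01 delta : R)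
    (u : R -> R) : Prop := {
  sol_neq0 : forall z, - delta < z < delta -> u z <> 0;
  sol_diff : forall z, - delta < z < delta -> ex_derive u z;
  sol_eq : forall z, - delta < z < delta ->
    is_derive (fun y => (y ^ 2 - delta' ^ 2) * Derive (fun x => u x ^ n) y) z
              (lambda * u z);
  sol_init : u 0 = u0;
  sol_init1 : is_derive u 0 u01
}.

Definition analytic_on (delta : R) (u : R -> R) : Prop :=
  forall z0, - delta < z0 < delta ->
  exists (r : R) (c : nat -> R), 0 < r /\
    forall z, Rabs (z - z0) < r -> is_pseries c (z - z0) (u z).

Definition taylor_coeff (u : R -> R) (i : nat) : R :=
  / INR (fact i) * Derive_n u i 0.

(* Main.v *)
Require Import Defs.
From Stdlib Require Import Reals Lra Lia.
From Coquelicot Require Import Coquelicot.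
Open Scope R_scope.

(** Write w = u^n = sum b_j z^j. The equation is linear in the pair (u, w):
    i(i+1) b_i - delta'^2 (i+1)(i+2) b_{i+2} = lambda a_i, while u^n = w amounts
    to n w u' = u w', i.e. sum_k (k(n+1) - j) a_k b_{j-k} = 0. The first relation
    gives |b_{i+2}| <= (|b_i| + |lambda a_i|) / delta'^2, the second gives
    |b_0 a_{m+1}| <= sum_{k<=m} |a_k b_{m+1-k}|. For small r a joint induction on
    partial sums then yields sum_{k>=1} |b_k| r^k <= |b_0|/2 and
    sum_k |a_k| r^k <= 2|a_0|, so both series converge.

    For uniqueness put w = v^n and W = (z^2 - delta'^2) w'. Then
    w' = W / (z^2 - delta'^2) and W' = lambda v; on a compact interval v keeps its
    sign and |v| >= m > 0, so v is a Lipschitz function of w, and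
    (w_1 - w_2)^2 + (W_1 - W_2)^2 vanishes by Gronwall. *)

(** * The recurrence for the coefficients *)

(** Table of the first [m] values of the recursion. Entries at index [m] and beyond hold the default
    [0], which a step function looking only below its index never sees. *)
Fixpoint course_upto (F : nat -> (nat -> R) -> R) (m : nat) : nat -> R :=
  match m with
  | O => fun _ => 0
  | S m' => fun j =>
      if Nat.eqb j m' then F m' (course_upto F m') else course_upto F m' j
  end.

Lemma course_of_values (F : nat -> (nat -> R) -> R) :
  (forall i f g, (forall k, (k < i)%nat -> f k = g k) -> F i f = F i g) ->
  exists f : nat -> R, forall i, f i = F i f.
Proof.
  intros HF; exists (fun i => course_upto F (S i) i); intros i.
  assert (Hle : forall m k, (k < m)%nat ->
            course_upto F m k = course_upto F (S k) k).
  { induction m as [|m IH]; intros k Hk; [lia|].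
    destruct (Nat.eq_dec k m) as [->|Hne]; [reflexivity|].
    rewrite <- IH by lia; simpl.
    now rewrite (proj2 (Nat.eqb_neq k m) Hne). }
  transitivity (F i (course_upto F i)).
  - simpl; now rewrite Nat.eqb_refl.
  - apply HF; intros k Hk; now apply Hle.
Qed.

Lemma power_coeff_ext (a a' : nat -> R) (n j : nat) :
  (forall k, (k <= j)%nat -> a k = a' k) ->
  power_coeff a n j = power_coeff a' n j.
Proof.
  induction j as [j IH] using (well_founded_induction Nat.lt_wf_0).
  intros H; destruct (Nat.eq_dec j 0) as [->|Hj].
  - now rewrite !power_coeff_0, H.
  - rewrite !power_coeff_pos by lia; rewrite H by lia; f_equal.
    apply sum_n_m_ext_loc; intros k Hk.
    rewrite H by lia; rewrite IH; [reflexivity|lia|].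
    intros l Hl; apply H; lia.
Qed.

Lemma sum_n_m_R_split0 (f : nat -> R) (j : nat) :
  sum_f_R0 f j = f 0%nat + sum_n_m f 1 j.
Proof. rewrite <- sum_n_Reals; unfold sum_n; rewrite sum_Sn_m by lia; reflexivity. Qed.

Lemma sum_n_m_R_last (f : nat -> R) (j : nat) :
  sum_n_m f 1 (S j) = sum_n_m f 1 j + f (S j).
Proof. rewrite sum_n_Sm by lia; reflexivity. Qed.

(** Coefficient form of n w u' = u w' with w = u^n. The term k = 0 is -j a_0 b_j, so for j > 0 this
    is the definition of b_j with its denominator cleared; for j = 0 the single term carries the
    factor 0. *)
Lemma power_coeff_log_derivative (a : nat -> R) (n j : nat) : a 0%nat <> 0 ->
  sum_f_R0 (fun k => (INR k * (INR n + 1) - INR j) * a k *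
                     power_coeff a n (j - k)) j = 0.
Proof.
  intros Ha; rewrite sum_n_m_R_split0, Nat.sub_0_r.
  destruct j as [|j].
  - rewrite sum_n_m_zero by lia; unfold zero; simpl; ring.
  - rewrite (power_coeff_pos a n (S j)) by lia.
    assert (INR (S j) <> 0) by (apply not_0_INR; lia).
    simpl INR at 1; field; auto.
Qed.

Definition recurrence_rhs (n : nat) (delta' lambda : R) (a : nat -> R)
    (i : nat) : R :=
  - (lambda * a i /
     (delta' ^ 2 * (INR i + 1) * (INR i + 2) * INR n * a 0%nat ^ (n - 1)))
  + 1 / (delta' ^ 2 * (INR i + 2) * INR n * a 0%nat ^ n) *
    (sum_n_m (fun k => (INR k * (INR n + 1) - INR i) *
                       a k * power_coeff a n (i - k)%nat) 1 i
     - delta' ^ 2 *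
       sum_n_m (fun k => (INR k * (INR n + 1) - INR i - 2) *
                         a k * power_coeff a n (i + 2 - k)%nat) 1 (i + 1)).

(** Both sums start at k = 1, so b is read at most at index i+1 and a at most at i+1. This makes the
    recurrence a legitimate definition of a_{i+2}. *)
Lemma recurrence_rhs_ext n delta' lambda (a a' : nat -> R) i :
  (forall k, (k < i + 2)%nat -> a k = a' k) ->
  recurrence_rhs n delta' lambda a i = recurrence_rhs n delta' lambda a' i.
Proof.
  intros H; unfold recurrence_rhs.
  rewrite !(H 0%nat), (H i) by lia.
  do 3 f_equal; [|f_equal]; apply sum_n_m_ext_loc; intros k Hk;
    rewrite H by lia; f_equal; apply power_coeff_ext; intros; apply H; lia.
Qed.

Lemma recurrence_solvable n delta' lambda u0 u01 :
  exists a : nat -> R, a 0%nat = u0 /\ a 1%nat = u01 /\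
    forall i, a (i + 2)%nat = recurrence_rhs n delta' lambda a i.
Proof.
  destruct (course_of_values (fun j f => match j with
     | O => u0 | 1%nat => u01 | S (S i) => recurrence_rhs n delta' lambda f i end))
    as [a Ha].
  - intros [|[|i]] f g H; auto. apply recurrence_rhs_ext; intros; apply H; lia.
  - exists a; split; [|split]; [apply (Ha 0%nat)|apply (Ha 1%nat)|].
    intros i; replace (i + 2)%nat with (S (S i)) by lia; apply Ha.
Qed.

(** The logarithmic-derivative identity at i evaluates the first sum as i a_0 b_i; at i+2, with the
    terms k = 0 and k = i+2 split off, it evaluates the second through b_{i+2} and a_{i+2}. After
    substitution a_{i+2} cancels, leaving a_0 times the coefficient relation of the equation. *)
Lemma recurrence_ode n delta' lambda (a : nat -> R) i :
  (0 < n)%nat -> delta' <> 0 -> a 0%nat <> 0 ->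
  a (i + 2)%nat = recurrence_rhs n delta' lambda a i ->
  INR i * (INR i + 1) * power_coeff a n i
  - delta' ^ 2 * ((INR i + 1) * (INR i + 2) * power_coeff a n (S (S i)))
  = lambda * a i.
Proof.
  intros Hn Hd Ha H.
  pose proof (pos_INR i) as Hi.
  assert (HN : INR n <> 0) by (apply not_0_INR; lia).
  assert (Hpow : a 0%nat ^ n = a 0%nat * a 0%nat ^ (n - 1)).
  { replace n with (S (n - 1)) at 1 by lia; reflexivity. }
  assert (HP : a 0%nat ^ (n - 1) <> 0) by now apply pow_nonzero.
  assert (E1 := power_coeff_log_derivative a n i Ha).
  rewrite sum_n_m_R_split0, Nat.sub_0_r in E1.
  assert (E2 := power_coeff_log_derivative a n (S (S i)) Ha).
  rewrite sum_n_m_R_split0, Nat.sub_0_r, sum_n_m_R_last, Nat.sub_diag,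
    power_coeff_0 in E2.
  unfold recurrence_rhs in H.
  rewrite (sum_n_m_ext_loc
    (fun k => (INR k * (INR n + 1) - INR i - 2) * a k * power_coeff a n (i + 2 - k))
    (fun k => (INR k * (INR n + 1) - INR (S (S i))) * a k * power_coeff a n (S (S i) - k))) in H.
  2:{ intros k Hk; replace (i + 2 - k)%nat with (S (S i) - k)%nat by lia.
      rewrite !S_INR; simpl; ring. }
  replace (i + 1)%nat with (S i) in H by lia.
  replace (i + 2)%nat with (S (S i)) in H by lia.
  rewrite !S_INR in *; change (INR 0) with 0 in *.
  set (S1 := sum_n_m _ _ _) in *.
  set (S2 := sum_n_m _ _ (S i)) in *.
  set (b2 := power_coeff a n (S (S i))) in *.
  set (b0 := power_coeff a n i) in *.
  set (a2 := a (S (S i))) in *.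
  rewrite Hpow in *. set (P := a 0%nat ^ (n - 1)) in *.
  set (a0 := a 0%nat) in *.
  assert (Q1 : S1 = INR i * a0 * b0) by lra.
  assert (Q2 : S2 = (INR i + 2) * a0 * b2 - (INR i + 2) * INR n * a2 * (a0 * P)) by lra.
  assert (H' : delta' ^ 2 * (INR i + 1) * (INR i + 2) * INR n * (a0 * P) * a2
    = - (lambda * a i * a0) + (INR i + 1) * (S1 - delta' ^ 2 * S2)).
  { rewrite H; field; repeat split; auto; lra. }
  rewrite Q1, Q2 in H'.
  apply (Rmult_eq_reg_l a0); [|exact Ha].
  lra.
Qed.

(** * Convergence *)

(** The triangle k + l <= N is summed by rows instead of by diagonals. *)
Lemma sum_cauchy_product (x y : nat -> R) (N : nat) :
  sum_f_R0 (fun m => sum_f_R0 (fun k => x k * y (m - k)%nat) m) N =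
  sum_f_R0 (fun k => x k * sum_f_R0 y (N - k)) N.
Proof.
  induction N as [|N IH]; [reflexivity|].
  rewrite tech5, IH, !(tech5 _ N), Nat.sub_diag.
  rewrite <- Rplus_assoc, <- sum_plus; simpl (sum_f_R0 y 0); f_equal.
  apply sum_eq; intros k Hk.
  replace (S N - k)%nat with (S (N - k)) by lia; rewrite tech5; ring.
Qed.

Lemma sum_f_R0_mono (x : nat -> R) (m N : nat) :
  (forall k, 0 <= x k) -> (m <= N)%nat -> sum_f_R0 x m <= sum_f_R0 x N.
Proof.
  intros Hx H; induction H as [|N H IH]; [lra|].
  rewrite tech5; specialize (Hx (S N)); lra.
Qed.

Lemma sum_cauchy_product_le (x y : nat -> R) (N : nat) :
  (forall k, 0 <= x k) -> (forall k, 0 <= y k) ->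
  sum_f_R0 (fun m => sum_f_R0 (fun k => x k * y (m - k)%nat) m) N <=
  sum_f_R0 x N * sum_f_R0 y N.
Proof.
  intros Hx Hy; rewrite sum_cauchy_product, Rmult_comm, scal_sum.
  apply sum_Rle; intros k Hk; apply Rmult_le_compat_l; [auto|].
  apply sum_f_R0_mono; auto; lia.
Qed.

Lemma sum_f_R0_shift (x : nat -> R) (N : nat) :
  sum_f_R0 x (S N) = x 0%nat + sum_f_R0 (fun k => x (S k)) N.
Proof.
  induction N as [|N IH]; [reflexivity|].
  rewrite tech5, IH, tech5; ring.
Qed.

Lemma term_le_sum_f_R0 (x : nat -> R) (N : nat) :
  (forall k, 0 <= x k) -> x N <= sum_f_R0 x N.
Proof.
  intros Hx; destruct N as [|N]; [simpl; lra|].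
  rewrite tech5; assert (0 <= sum_f_R0 x N) by (now apply cond_pos_sum); lra.
Qed.

Section Majorant.

Variables (n : nat) (d lambda : R) (a b : nat -> R).
Hypothesis Hn : (0 < n)%nat.
Hypothesis Hd : 0 < d.
Hypothesis Hb0 : b 0%nat <> 0.
Hypothesis log_derivative : forall j,
  sum_f_R0 (fun k => (INR k * (INR n + 1) - INR j) * a k * b (j - k)%nat) j = 0.
Hypothesis ode : forall i,
  INR i * (INR i + 1) * b i - d ^ 2 * ((INR i + 1) * (INR i + 2) * b (S (S i)))
  = lambda * a i.

(** The term k = m+1 of the identity is n (m+1) b_0 a_{m+1}. Every other coefficient k(n+1) - (m+1),
    with k <= m, has absolute value at most n (m+1), so that factor divides out. *)
Lemma root_coeff_le (m : nat) :
  Rabs (b 0%nat) * Rabs (a (S m)) <=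
  sum_f_R0 (fun k => Rabs (a k) * Rabs (b (S (m - k)))) m.
Proof.
  assert (HN : 1 <= INR n) by (apply (le_INR 1); lia).
  assert (HM : 0 < INR (S m)) by (apply lt_0_INR; lia).
  assert (H := log_derivative (S m)).
  rewrite tech5, Nat.sub_diag in H.
  assert (E : b 0%nat * a (S m) * (INR n * INR (S m)) =
    - sum_f_R0 (fun k => (INR k * (INR n + 1) - INR (S m)) * a k * b (S m - k)%nat) m)
    by lra.
  apply (f_equal Rabs) in E.
  rewrite Rabs_Ropp, !Rabs_mult, (Rabs_pos_eq (INR n)), (Rabs_pos_eq (INR (S m))) in E by lra.
  apply (Rmult_le_reg_r (INR n * INR (S m))); [nra|].
  rewrite E.
  eapply Rle_trans; [apply Rsum_abs|].
  rewrite (Rmult_comm (sum_f_R0 _ _)), scal_sum.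
  apply sum_Rle; intros k Hk.
  replace (S m - k)%nat with (S (m - k)) by lia.
  rewrite !Rabs_mult, Rmult_assoc, (Rmult_comm (Rabs _)).
  apply Rmult_le_compat_l; [apply Rmult_le_pos; apply Rabs_pos|].
  assert (INR k <= INR m) by now apply le_INR.
  rewrite S_INR in *; assert (0 <= INR k) by apply pos_INR.
  apply Rabs_le; split; nra.
Qed.

(** After division by (i+1)(i+2), the factors i(i+1) and 1 become ratios at most 1. *)
Lemma ode_coeff_le (i : nat) :
  d ^ 2 * Rabs (b (S (S i))) <= Rabs (b i) + Rabs lambda * Rabs (a i).
Proof.
  assert (Hi := pos_INR i).
  assert (Hdd : 0 < d ^ 2) by now apply pow_lt.
  assert (E : d ^ 2 * b (S (S i)) * ((INR i + 1) * (INR i + 2)) =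
     b i * (INR i * (INR i + 1)) - lambda * a i) by (rewrite <- ode; ring).
  apply (Rmult_le_reg_r ((INR i + 1) * (INR i + 2))); [nra|].
  apply (f_equal Rabs) in E.
  rewrite !Rabs_mult, (Rabs_pos_eq (d ^ 2)), (Rabs_pos_eq (INR i + 1)),
    (Rabs_pos_eq (INR i + 2)) in E by lra.
  rewrite E.
  eapply Rle_trans; [apply Rabs_triang|].
  rewrite Rabs_Ropp, !Rabs_mult, (Rabs_pos_eq (INR i)), (Rabs_pos_eq (INR i + 1)) by lra.
  assert (0 <= Rabs (b i)) by apply Rabs_pos.
  assert (0 <= Rabs lambda * Rabs (a i)) by (apply Rmult_le_pos; apply Rabs_pos).
  rewrite Rmult_plus_distr_r; apply Rplus_le_compat.
  - apply Rmult_le_compat_l; nra.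
  - rewrite <- (Rmult_1_r (Rabs lambda * Rabs (a i))) at 1.
    apply Rmult_le_compat_l; nra.
Qed.

Let p (r : R) (k : nat) := Rabs (a k) * r ^ k.
Let q (r : R) (k : nat) := Rabs (b k) * r ^ k.

(** Let P_N be the partial sums of [p r] and Y that of the shifted [q r]. Summing [root_coeff_le]
    against r^(m+1) gives |b_0| (P_{N+1} - |a_0|) <= P_N Y <= P_{N+1} |b_0| / 2, and half of P_{N+1}
    is absorbed on the left. *)
Lemma root_partial_sums_le (r : R) (N : nat) : 0 <= r ->
  sum_f_R0 (fun k => q r (S k)) N <= Rabs (b 0%nat) / 2 ->
  sum_f_R0 (p r) (S N) <= 2 * Rabs (a 0%nat).
Proof.
  intros Hr HY.
  assert (Hp : forall k, 0 <= p r k)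
    by (intros; apply Rmult_le_pos; [apply Rabs_pos|now apply pow_le]).
  assert (Hq : forall k, 0 <= q r k)
    by (intros; apply Rmult_le_pos; [apply Rabs_pos|now apply pow_le]).
  assert (HB : 0 < Rabs (b 0%nat)) by now apply Rabs_pos_lt.
  assert (Hstep : Rabs (b 0%nat) * sum_f_R0 (fun k => p r (S k)) N <=
     sum_f_R0 (p r) N * sum_f_R0 (fun k => q r (S k)) N).
  { eapply Rle_trans; [|apply sum_cauchy_product_le; auto].
    rewrite scal_sum; apply sum_Rle; intros m _.
    unfold p at 1.
    replace (Rabs (a (S m)) * r ^ S m * Rabs (b 0%nat))
      with (r ^ S m * (Rabs (b 0%nat) * Rabs (a (S m)))) by ring.
    eapply Rle_trans.
    { apply Rmult_le_compat_l; [now apply pow_le|apply root_coeff_le]. }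
    rewrite scal_sum; apply Req_le, sum_eq; intros k Hk; unfold p, q.
    replace (S m) with (k + S (m - k))%nat at 1 by lia.
    rewrite pow_add; ring. }
  assert (HPN : sum_f_R0 (p r) N <= sum_f_R0 (p r) (S N))
    by (apply sum_f_R0_mono; auto).
  assert (HP0 : 0 <= sum_f_R0 (p r) N) by now apply cond_pos_sum.
  assert (Hsplit : sum_f_R0 (p r) (S N) =
    Rabs (a 0%nat) + sum_f_R0 (fun k => p r (S k)) N).
  { rewrite sum_f_R0_shift; unfold p at 1; simpl; ring. }
  assert (H2 : sum_f_R0 (fun k => p r (S k)) N <= sum_f_R0 (p r) N / 2).
  { apply (Rmult_le_reg_l (Rabs (b 0%nat))); [exact HB|].
    eapply Rle_trans; [exact Hstep|].
    replace (Rabs (b 0%nat) * (sum_f_R0 (p r) N / 2))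
      with (sum_f_R0 (p r) N * (Rabs (b 0%nat) / 2)) by field.
    now apply Rmult_le_compat_l. }
  lra.
Qed.

(** Induction on N. The bound for b passes to a by [root_partial_sums_le]; the equation then bounds
    the terms of index at least 2 by r^2 K <= r K, the shift by two indices supplying r^2. Adding
    the term r |b_1|, the smallness condition on r restores the bound. *)
Lemma power_partial_sums_le (r : R) (N : nat) : 0 <= r <= 1 ->
  r * (Rabs (b 1%nat) +
       (2 * Rabs (b 0%nat) + Rabs lambda * (2 * Rabs (a 0%nat))) / d ^ 2)
    <= Rabs (b 0%nat) / 2 ->
  sum_f_R0 (fun k => q r (S k)) N <= Rabs (b 0%nat) / 2.
Proof.
  intros Hr HK.
  assert (Hdd : 0 < d ^ 2) by now apply pow_lt.
  assert (Hp : forall k, 0 <= p r k)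
    by (intros; apply Rmult_le_pos; [apply Rabs_pos|now apply pow_le]).
  assert (Hq : forall k, 0 <= q r k)
    by (intros; apply Rmult_le_pos; [apply Rabs_pos|now apply pow_le]).
  assert (HB : 0 < Rabs (b 0%nat)) by now apply Rabs_pos_lt.
  assert (HA : 0 <= Rabs (a 0%nat)) by apply Rabs_pos.
  assert (HL : 0 <= Rabs lambda) by apply Rabs_pos.
  set (K := (2 * Rabs (b 0%nat) + Rabs lambda * (2 * Rabs (a 0%nat))) / d ^ 2) in *.
  assert (HK0 : 0 <= K).
  { apply Rmult_le_pos; [nra|]. left; now apply Rinv_0_lt_compat. }
  induction N as [|N IH].
  - simpl; unfold q; simpl.
    assert (0 <= r * K) by nra. nra.
  - assert (HP := root_partial_sums_le r N (proj1 Hr) IH).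
    rewrite sum_f_R0_shift.
    assert (HPN : sum_f_R0 (p r) N <= sum_f_R0 (p r) (S N))
      by (apply sum_f_R0_mono; auto).
    assert (HQN : sum_f_R0 (q r) N <= 2 * Rabs (b 0%nat)).
    { apply Rle_trans with (sum_f_R0 (q r) (S N)); [apply sum_f_R0_mono; auto|].
      rewrite sum_f_R0_shift; unfold q at 1; simpl (r ^ 0); lra. }
    assert (Hsum : d ^ 2 * sum_f_R0 (fun k => q r (S (S k))) N <=
      r ^ 2 * (sum_f_R0 (q r) N + Rabs lambda * sum_f_R0 (p r) N)).
    { rewrite (scal_sum (p r)), <- sum_plus, !scal_sum.
      apply sum_Rle; intros i _; unfold p, q.
      replace (Rabs (b (S (S i))) * r ^ S (S i) * d ^ 2)
        with (r ^ i * r ^ 2 * (d ^ 2 * Rabs (b (S (S i))))) by (simpl; ring).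
      replace ((Rabs (b i) * r ^ i + Rabs (a i) * r ^ i * Rabs lambda) * r ^ 2)
        with (r ^ i * r ^ 2 * (Rabs (b i) + Rabs lambda * Rabs (a i))) by ring.
      apply Rmult_le_compat_l; [|apply ode_coeff_le].
      apply Rmult_le_pos; apply pow_le; lra. }
    assert (Hsum' : sum_f_R0 (fun k => q r (S (S k))) N <= r ^ 2 * K).
    { apply (Rmult_le_reg_l (d ^ 2)); [exact Hdd|].
      eapply Rle_trans; [exact Hsum|].
      replace (d ^ 2 * (r ^ 2 * K)) with
       (r ^ 2 * (2 * Rabs (b 0%nat) + Rabs lambda * (2 * Rabs (a 0%nat))))
       by (unfold K; field; lra).
      apply Rmult_le_compat_l; [apply pow_le; lra|].
      apply Rplus_le_compat; [exact HQN|].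
      apply Rmult_le_compat_l; lra. }
    assert (r ^ 2 * K <= r * K) by (apply Rmult_le_compat_r; simpl; nra).
    unfold q at 1; rewrite pow_1. lra.
Qed.

Lemma coeff_geometric_bound : exists r M : R, 0 < r /\
  forall k, Rabs (a k * r ^ k) <= M /\ Rabs (b k * r ^ k) <= M.
Proof.
  assert (Hdd : 0 < d ^ 2) by now apply pow_lt.
  assert (HB : 0 < Rabs (b 0%nat)) by now apply Rabs_pos_lt.
  set (K := Rabs (b 1%nat) +
       (2 * Rabs (b 0%nat) + Rabs lambda * (2 * Rabs (a 0%nat))) / d ^ 2).
  assert (HK : 0 <= K).
  { apply Rplus_le_le_0_compat; [apply Rabs_pos|].
    assert (0 <= Rabs lambda * (2 * Rabs (a 0%nat))).
    { apply Rmult_le_pos; [apply Rabs_pos|]. assert (H := Rabs_pos (a 0%nat)); lra. }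
    apply Rmult_le_pos; [lra|]. left; now apply Rinv_0_lt_compat. }
  (* The second argument enforces r K <= |b_0| / 2; the [+ 1] makes the denominator positive from
     [0 <= K] alone. *)
  set (r := Rmin 1 (Rabs (b 0%nat) / 2 / (K + 1))).
  assert (Hq0 : 0 < Rabs (b 0%nat) / 2 / (K + 1)).
  { apply Rdiv_lt_0_compat; lra. }
  assert (Hr0 : 0 < r) by (unfold r; apply Rmin_glb_lt; lra).
  assert (Hr1 : r <= 1) by apply Rmin_l.
  assert (HrK : r * K <= Rabs (b 0%nat) / 2).
  { apply Rle_trans with (r * (K + 1)); [nra|].
    apply Rle_trans with (Rabs (b 0%nat) / 2 / (K + 1) * (K + 1)).
    - apply Rmult_le_compat_r; [lra|apply Rmin_r].
    - apply Req_le; field; lra. }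
  assert (HY : forall N, sum_f_R0 (fun k => q r (S k)) N <= Rabs (b 0%nat) / 2).
  { intros N; apply power_partial_sums_le; [lra|exact HrK]. }
  assert (Hp : forall k, 0 <= p r k)
    by (intros; apply Rmult_le_pos; [apply Rabs_pos|apply pow_le; lra]).
  assert (Hq : forall k, 0 <= q r k)
    by (intros; apply Rmult_le_pos; [apply Rabs_pos|apply pow_le; lra]).
  assert (HA := Rabs_pos (a 0%nat)).
  exists r, (2 * Rabs (a 0%nat) + Rabs (b 0%nat)); split; [exact Hr0|].
  intros k; rewrite !Rabs_mult, <- RPow_abs, (Rabs_pos_eq r) by lra; split.
  - apply Rle_trans with (2 * Rabs (a 0%nat)); [|lra].
    eapply Rle_trans; [apply (term_le_sum_f_R0 (p r)); auto|].
    eapply Rle_trans; [|apply (root_partial_sums_le r k); [lra|auto]].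
    apply sum_f_R0_mono; auto.
  - destruct k as [|k]; [simpl; lra|].
    apply Rle_trans with (Rabs (b 0%nat) / 2); [|lra].
    eapply Rle_trans; [|apply (HY k)].
    apply (term_le_sum_f_R0 (fun k => q r (S k))); auto.
Qed.

End Majorant.

(** * The equation for power series *)

Lemma geometric_bound_CV_radius (a : nat -> R) (r M z : R) :
  (forall k, Rabs (a k * r ^ k) <= M) -> Rabs z < r ->
  Rbar_lt (Rabs z) (CV_radius a).
Proof.
  intros H Hz; apply Rbar_lt_le_trans with r; [exact Hz|].
  apply (proj1 (CV_radius_bounded a)); now exists M.
Qed.

Lemma is_derive_0_constant (f : R -> R) (r z : R) :
  (forall x, Rabs x < r -> is_derive f x 0) -> Rabs z < r -> f z = f 0.
Proof.
  intros H Hz.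
  assert (Hin : forall x, Rmin 0 z <= x <= Rmax 0 z -> Rabs x < r).
  { intros x Hx; apply Rle_lt_trans with (Rabs z); [|exact Hz].
    revert Hx; unfold Rmin, Rmax, Rabs.
    destruct (Rle_dec 0 z), (Rcase_abs x), (Rcase_abs z); lra. }
  destruct (MVT_gen f 0 z (fun _ => 0)) as [c [_ Hc]].
  - intros x Hx; apply H, Hin; lra.
  - intros x Hx; apply derivable_continuous_pt, ex_derive_Reals_0.
    exists 0; now apply H, Hin.
  - lra.
Qed.

Section PowerSeriesSolution.

Variables (n : nat) (d lambda rho : R) (a b : nat -> R).
Hypothesis CVa : forall z, Rabs z < rho -> Rbar_lt (Rabs z) (CV_radius a).
Hypothesis CVb : forall z, Rabs z < rho -> Rbar_lt (Rabs z) (CV_radius b).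

(** Comparison of the coefficients of z^j in two Cauchy products. Differentiation shifts indices by
    one, so the relation used is the one at j+1; the end terms added in [E] and [E2] carry the
    factor 0. *)
Lemma PSeries_log_derivative (z : R) :
  (forall j, sum_f_R0 (fun k => (INR k * (INR n + 1) - INR j) * a k *
                                b (j - k)%nat) j = 0) ->
  Rabs z < rho ->
  INR n * PSeries b z * PSeries (PS_derive a) z =
  PSeries a z * PSeries (PS_derive b) z.
Proof.
  intros H1 Hz.
  assert (CVa' : Rbar_lt (Rabs z) (CV_radius (PS_derive a)))
    by (rewrite CV_radius_derive; auto).
  assert (CVb' : Rbar_lt (Rabs z) (CV_radius (PS_derive b)))
    by (rewrite CV_radius_derive; auto).
  rewrite Rmult_assoc, (Rmult_comm (PSeries b z)).
  rewrite <- !PSeries_mult, <- PSeries_scal by auto.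
  apply PSeries_ext; intros j.
  unfold PS_scal, scal; simpl; unfold mult; simpl.
  unfold PS_mult, PS_derive.
  assert (E : sum_f_R0 (fun k => INR (S k) * a (S k) * b (j - k)%nat) j =
    sum_f_R0 (fun k => INR k * a k * b (S j - k)%nat) (S j)).
  { rewrite (decomp_sum _ (S j)) by lia; simpl (INR 0); simpl pred.
    replace (0 * a 0%nat * b (S j - 0)%nat) with 0 by ring.
    now rewrite Rplus_0_l. }
  assert (E2 : sum_f_R0 (fun k => a k * (INR (S (j - k)) * b (S (j - k)))) j =
     sum_f_R0 (fun k => (INR (S j) - INR k) * a k * b (S j - k)%nat) (S j)).
  { rewrite tech5; replace (INR (S j) - INR (S j)) with 0 by ring.
    rewrite !Rmult_0_l, Rplus_0_r; apply sum_eq; intros k Hk.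
    replace (S j - k)%nat with (S (j - k)) by lia.
    replace (INR (S (j - k))) with (INR (S j) - INR k); [ring|].
    rewrite <- minus_INR by lia; f_equal; lia. }
  rewrite E, E2, scal_sum.
  apply Rminus_diag_uniq; rewrite <- minus_sum.
  rewrite <- (H1 (S j)); apply sum_eq; intros k _; ring.
Qed.

(** The quotient w / u^n has zero derivative by the logarithmic relation, and its value at 0 is b_0
    / a_0^n = 1. *)
Lemma power_identity (r z : R) :
  (forall x, Rabs x < rho -> INR n * PSeries b x * PSeries (PS_derive a) x =
     PSeries a x * PSeries (PS_derive b) x) ->
  b 0%nat = a 0%nat ^ n ->
  r <= rho -> (forall x, Rabs x < r -> PSeries a x <> 0) ->
  Rabs z < r -> PSeries a z ^ n = PSeries b z.
Proof.
  intros Hlog Hb0 Hr Hu Hz.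
  assert (Hpos : 0 < r) by (apply Rle_lt_trans with (Rabs z); auto; apply Rabs_pos).
  assert (E : PSeries b z / PSeries a z ^ n = PSeries b 0 / PSeries a 0 ^ n).
  { apply (is_derive_0_constant (fun x => PSeries b x / PSeries a x ^ n) r);
      [|exact Hz].
    intros x Hx.
    assert (HxR : Rabs x < rho) by lra.
    assert (Da := is_derive_PSeries a x (CVa x HxR)).
    assert (Db := is_derive_PSeries b x (CVb x HxR)).
    assert (Hux := Hu x Hx).
    assert (D := is_derive_div _ _ x _ _ Db (is_derive_pow _ n x _ Da)
                   (pow_nonzero _ n Hux)).
    replace 0 with ((PSeries (PS_derive b) x * PSeries a x ^ n -
      PSeries b x * (INR n * PSeries (PS_derive a) x *
        PSeries a x ^ Init.Nat.pred n)) / (PSeries a x ^ n) ^ 2); [exact D|].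
    unfold Rdiv; apply Rmult_eq_0_compat_r.
    (* For exponent 0 no power of u can be factored out, but the relation then reads u w' = 0 and
       yields w' = 0 directly. *)
    destruct n as [|m].
    - assert (E0 := Hlog x HxR); simpl in E0 |- *.
      assert (PSeries (PS_derive b) x = 0) by (apply (Rmult_eq_reg_l (PSeries a x)); lra).
      lra.
    - simpl pred; rewrite <- tech_pow_Rmult.
      transitivity (PSeries a x ^ m * (PSeries a x * PSeries (PS_derive b) x
        - INR (S m) * PSeries b x * PSeries (PS_derive a) x)); [ring|].
      rewrite Hlog by auto; ring. }
  rewrite !PSeries_0, Hb0 in E.
  assert (Ha0 : a 0%nat <> 0).
  { rewrite <- PSeries_0; apply Hu; rewrite Rabs_R0; exact Hpos. }
  assert (Hz' := pow_nonzero _ n (Hu z Hz)).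
  assert (Ha' := pow_nonzero _ n Ha0).
  apply (Rmult_eq_reg_r (/ PSeries a z ^ n)); [|now apply Rinv_neq_0_compat].
  unfold Rdiv in E; rewrite E, !Rinv_r by auto; reflexivity.
Qed.

Lemma PSeries_ode (z : R) :
  (forall i, INR i * (INR i + 1) * b i
     - d ^ 2 * ((INR i + 1) * (INR i + 2) * b (S (S i))) = lambda * a i) ->
  Rabs z < rho ->
  is_derive (fun y => (y ^ 2 - d ^ 2) * PSeries (PS_derive b) y) z
    (lambda * PSeries a z).
Proof.
  intros H2 Hz.
  set (b1 := PS_derive b); set (b2 := PS_derive b1).
  assert (C1 : Rbar_lt (Rabs z) (CV_radius b1))
    by (unfold b1; rewrite CV_radius_derive; auto).
  assert (C2 : Rbar_lt (Rabs z) (CV_radius b2))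
    by (unfold b2; rewrite CV_radius_derive; auto).
  assert (X1 := CV_radius_inside _ _ C1).
  assert (X2 := CV_radius_inside _ _ C2).
  assert (D1 := is_derive_PSeries b1 z C1).
  assert (Dq : is_derive (fun y => y ^ 2 - d ^ 2) z (2 * z))
    by (auto_derive; auto; ring).
  assert (D := is_derive_mult _ _ z _ _ Dq D1 Rmult_comm).
  replace (lambda * PSeries a z) with
    (2 * z * PSeries b1 z + (z ^ 2 - d ^ 2) * PSeries b2 z); [exact D|].
  assert (Xi : ex_pseries (PS_incr_1 b2) z) by now apply ex_pseries_incr_1.
  assert (Xs : ex_pseries (PS_scal 2 b1) z)
    by (apply ex_pseries_scal; [apply Rmult_comm|auto]).
  assert (Xp : ex_pseries (PS_plus (PS_scal 2 b1) (PS_incr_1 b2)) z)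
    by now apply ex_pseries_plus.
  (* The derivative is regrouped as z (2 w' + z w'') - d^2 w'', so that each multiplication by z is
     a [PS_incr_1]. *)
  transitivity (PSeries (PS_plus
     (PS_incr_1 (PS_plus (PS_scal 2 b1) (PS_incr_1 b2)))
     (PS_scal (- d ^ 2) b2)) z).
  - rewrite PSeries_plus.
    + rewrite PSeries_incr_1, PSeries_plus, PSeries_incr_1, !PSeries_scal by auto.
      ring.
    + now apply ex_pseries_incr_1.
    + apply ex_pseries_scal; [apply Rmult_comm|auto].
  - rewrite <- PSeries_scal; apply PSeries_ext; intros i.
    unfold PS_plus, PS_scal, PS_incr_1, b2, b1, PS_derive, plus, scal, zero;
      simpl; unfold mult; simpl.
    rewrite <- H2.
    (* Two nested shifts pad with zeros, so the indices 0 and 1 are separate. *)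
    destruct i as [|[|i]]; [simpl; ring|simpl; ring|].
    change (match i with 0%nat => 1 | S _ => INR i + 1 end) with (INR (S i)).
    rewrite !S_INR; ring.
Qed.

End PowerSeriesSolution.

Lemma PSeries_neq0_near0 (a : nat -> R) :
  Rbar_lt 0 (CV_radius a) -> a 0%nat <> 0 ->
  exists r, 0 < r /\ forall z, Rabs z < r -> PSeries a z <> 0.
Proof.
  intros HC Ha.
  assert (Hc : continuity_pt (PSeries a) 0)
    by (apply PSeries_continuity; rewrite Rabs_R0; exact HC).
  destruct (continuous_neq_0 (PSeries a) 0 Hc) as [r Hr].
  { now rewrite PSeries_0. }
  exists r; split; [apply cond_pos|].
  intros z Hz; rewrite <- (Rplus_0_l z); apply Hr; exact Hz.
Qed.

(** * Change of centre of a power series *)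

(* The [h ^ k] part of [a m * (z0 + h) ^ m]. The test is needed because
   [Binomial.C m k] is not [0] for [m < k]. *)
Definition recenter_term (a : nat -> R) (z0 h : R) (m k : nat) : R :=
  if Nat.leb k m then a m * (Binomial.C m k * h ^ k * z0 ^ (m - k)) else 0.

Lemma recenter_term_sum a z0 h m K : (m <= K)%nat ->
  sum_f_R0 (recenter_term a z0 h m) K = a m * (z0 + h) ^ m.
Proof.
  intros H; induction H as [|K H IH].
  - rewrite Rplus_comm, binomial, scal_sum; apply sum_eq; intros k Hk.
    unfold recenter_term; rewrite (proj2 (Nat.leb_le k m) Hk); ring.
  - rewrite tech5, IH; unfold recenter_term.
    rewrite (proj2 (Nat.leb_gt (S K) m)) by lia; ring.
Qed.

Lemma recenter_term_abs a z0 h m k :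
  Rabs (recenter_term a z0 h m k) =
  recenter_term (fun j => Rabs (a j)) (Rabs z0) (Rabs h) m k.
Proof.
  unfold recenter_term; destruct (Nat.leb k m); [|apply Rabs_R0].
  rewrite !Rabs_mult, <- !RPow_abs; do 3 f_equal; apply Rabs_pos_eq.
  unfold Binomial.C; apply Rlt_le, Rdiv_lt_0_compat;
    [|apply Rmult_lt_0_compat]; apply INR_fact_lt_0.
Qed.

(** The binomial expansion of the absolute values, summed up to [max K m] so that it is complete,
    dominates any partial sum. *)
Lemma recenter_term_abs_sum_le a z0 h m K :
  sum_f_R0 (fun k => Rabs (recenter_term a z0 h m k)) K <=
  Rabs (a m) * (Rabs z0 + Rabs h) ^ m.
Proof.
  rewrite <- (recenter_term_sum (fun j => Rabs (a j)) _ _ m (max K m)) by lia.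
  rewrite (sum_eq _ _ K (fun k _ => recenter_term_abs a z0 h m k)).
  apply sum_f_R0_mono; [|lia].
  intros k; rewrite <- recenter_term_abs; apply Rabs_pos.
Qed.

Lemma sum_f_R0_Series (t : nat -> nat -> R) (K : nat) :
  (forall k, ex_series (fun m => t m k)) ->
  ex_series (fun m => sum_f_R0 (t m) K) /\
  sum_f_R0 (fun k => Series (fun m => t m k)) K =
  Series (fun m => sum_f_R0 (t m) K).
Proof.
  intros H; induction K as [|K [IH1 IH2]]; [now split; [apply H|]|].
  split; simpl.
  - now apply (ex_series_plus (fun m => sum_f_R0 (t m) K)).
  - now rewrite IH2, Series_plus.
Qed.

(** Each a_m (z0 + h)^m is expanded binomially and the two summations are exchanged. The double
    series is dominated by [g], which converges because |z0| + |h| < r. *)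
Lemma PSeries_recenter (a : nat -> R) (r z0 : R) :
  (forall z, Rabs z < r -> Rbar_lt (Rabs z) (CV_radius a)) ->
  exists c : nat -> R, forall z, Rabs (z - z0) < r - Rabs z0 ->
    is_pseries c (z - z0) (PSeries a z).
Proof.
  intros CVa.
  (* Setting h = 1 strips the factor h^k and leaves the coefficient. *)
  exists (fun k => Series (fun m => recenter_term a z0 1 m k)).
  intros z Hz; set (h := z - z0) in *.
  set (t := recenter_term a z0 h).
  set (g := fun m => Rabs (a m) * (Rabs z0 + Rabs h) ^ m).
  assert (Hs : 0 <= Rabs z0 + Rabs h)
    by (apply Rplus_le_le_0_compat; apply Rabs_pos).
  assert (Hzr : Rabs z < r).
  { replace z with (z0 + h) by (unfold h; ring).
    eapply Rle_lt_trans; [apply Rabs_triang|lra]. }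
  assert (Hg : ex_series g).
  { apply ex_series_ext with (fun m => Rabs (a m * (Rabs z0 + Rabs h) ^ m)).
    - intros m; unfold g; rewrite Rabs_mult, <- RPow_abs.
      now rewrite (Rabs_pos_eq (Rabs z0 + Rabs h)).
    - apply CV_disk_inside, CVa; rewrite Rabs_pos_eq by exact Hs; lra. }
  assert (Hsum : forall m K, Rabs (sum_f_R0 (t m) K) <= g m).
  { intros m K; eapply Rle_trans; [apply Rsum_abs|apply recenter_term_abs_sum_le]. }
  assert (Ht : forall k, ex_series (fun m => t m k)).
  { intros k; apply (ex_series_le (fun m => t m k) g); [|exact Hg].
    intros m; eapply Rle_trans; [|apply (recenter_term_abs_sum_le a z0 h m k)].
    apply (term_le_sum_f_R0 (fun k => Rabs (recenter_term a z0 h m k))).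
    intros; apply Rabs_pos. }
  assert (Hf : forall m K, (m <= K)%nat -> sum_f_R0 (t m) K = a m * z ^ m).
  { intros m K HK; unfold t; rewrite recenter_term_sum by exact HK.
    do 2 f_equal; unfold h; ring. }
  assert (Hfex : ex_series (fun m => a m * z ^ m)).
  { apply ex_series_Rabs, CV_disk_inside, CVa, Hzr. }
  apply is_pseries_R, is_series_Reals.
  assert (Hgl := proj1 (is_series_Reals _ _) (Series_correct _ Hg)).
  intros eps Heps.
  destruct (Hgl (eps / 2)) as [N HN]; [lra|].
  exists N; intros K HK; specialize (HN K HK).
  rewrite (sum_eq _ (fun k => Series (fun m => t m k))).
  2:{ intros k _; rewrite <- Series_scal_r; apply Series_ext; intros m.
      unfold t, recenter_term; destruct (Nat.leb k m); [rewrite pow1|]; ring. }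
  destruct (sum_f_R0_Series t K Ht) as [Hex ->].
  unfold PSeries, R_dist in *; rewrite Rabs_minus_sym.
  rewrite <- Series_minus by assumption.
  (* The error of truncating the k-sum at [K] vanishes for m <= K, where the expansion is already
     complete, and is at most [2 * g m] otherwise. The total error is thus at most twice a tail of
     [g], whence the [eps / 2] above. *)
  set (e := fun m => a m * z ^ m - sum_f_R0 (t m) K).
  assert (He : forall m, Rabs (e m) <= 2 * g m).
  { intros m; unfold e; rewrite <- (Hf m m) by lia.
    assert (H1 := Hsum m K); assert (H2 := Hsum m m).
    eapply Rle_trans; [apply Rabs_triang|]; rewrite Rabs_Ropp; lra. }
  assert (Hgg : ex_series (fun m => 2 * g m)) by now apply (ex_series_scal 2 g).
  assert (Heex : ex_series e).
  { apply (ex_series_le e (fun m => 2 * g m)); auto. }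
  assert (H0 : sum_f_R0 e K = 0).
  { apply sum_eq_R0; intros m Hm; unfold e; rewrite Hf by lia; ring. }
  assert (Hgg' : ex_series (fun k => 2 * g (S K + k)%nat))
    by now apply (ex_series_incr_n (fun m => 2 * g m) (S K)).
  rewrite (Series_incr_n e (S K)) by (lia || assumption).
  simpl pred; rewrite H0, Rplus_0_l.
  eapply Rle_lt_trans.
  { apply Series_Rabs.
    apply (@ex_series_le R_AbsRing R_CompleteNormedModule
      (fun k => Rabs (e (S K + k)%nat)) (fun k => 2 * g (S K + k)%nat)); [|exact Hgg'].
    intros k; eapply Rle_trans; [|apply He]. apply Req_le, Rabs_Rabsolu. }
  eapply Rle_lt_trans.
  { apply (Series_le _ (fun k => 2 * g (S K + k)%nat)); [|exact Hgg'].
    intros k; split; [apply Rabs_pos|apply He]. }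
  rewrite Series_scal_l.
  rewrite (Series_incr_n g (S K)) in HN by (lia || assumption).
  simpl pred in HN; rewrite Rabs_minus_sym in HN.
  apply Rle_lt_trans with (2 * Rabs (sum_f_R0 g K + Series (fun k => g (S K + k)%nat) - sum_f_R0 g K)); [|lra].
  apply Rmult_le_compat_l; [lra|].
  eapply Rle_trans; [|apply Rle_abs]; apply Req_le; ring.
Qed.

(** * Uniqueness *)

Lemma is_derive_eq_value (f : R -> R) (x l l' : R) :
  l = l' -> is_derive f x l -> is_derive f x l'.
Proof. now intros ->. Qed.

(** The integrating factor exp(-s K x) makes the product with E nonincreasing as x moves away from 0
    towards z; the mean value theorem then compares it with its value 0 at the origin. *)
Lemma gronwall_0 (E D : R -> R) (K Z z : R) :
  (forall x, Rabs x <= Z -> is_derive E x (D x)) ->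
  (forall x, Rabs x <= Z -> Rabs (D x) <= K * E x) ->
  E 0 = 0 -> Rabs z <= Z -> E z <= 0.
Proof.
  intros HD HK H0 Hz.
  assert (Hs : exists s, (s = 1 \/ s = -1) /\ 0 <= s * z).
  { destruct (Rle_dec 0 z); [exists 1|exists (-1)]; lra. }
  destruct Hs as [s [Hs Hsz]].
  assert (Hin : forall x, Rmin 0 z <= x <= Rmax 0 z -> Rabs x <= Z).
  { intros x Hx; apply Rle_trans with (Rabs z); [|exact Hz].
    revert Hx; unfold Rmin, Rmax, Rabs.
    destruct (Rle_dec 0 z), (Rcase_abs x), (Rcase_abs z); lra. }
  assert (HF : forall x, Rabs x <= Z ->
    is_derive (fun x => E x * exp (- (s * K * x))) x
      ((D x - s * K * E x) * exp (- (s * K * x)))).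
  { intros x Hx; assert (HDx := HD x Hx).
    assert (He : is_derive (fun x => exp (- (s * K * x))) x
                   (- (s * K) * exp (- (s * K * x)))) by (auto_derive; auto; ring).
    eapply is_derive_eq_value; [|exact (is_derive_mult _ _ x _ _ HDx He Rmult_comm)].
    unfold plus, mult; simpl; ring. }
  (* The sign [s] of [z] treats both sides of [0] at once. *)
  destruct (MVT_gen (fun x => E x * exp (- (s * K * x))) 0 z
     (fun x => (D x - s * K * E x) * exp (- (s * K * x)))) as [c [Hc Heq]].
  - intros x Hx; apply HF, Hin; lra.
  - intros x Hx; apply derivable_continuous_pt, ex_derive_Reals_0.
    eexists; now apply HF, Hin.
  - rewrite H0, Rmult_0_l, !Rminus_0_r in Heq.
    assert (HDc := HK c (Hin c Hc)).
    assert (He := exp_pos (- (s * K * c))).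
    assert (Hez := exp_pos (- (s * K * z))).
    apply Rabs_le_between in HDc.
    assert (E z * exp (- (s * K * z)) <= 0).
    { rewrite Heq.
      (* Uses s^2 = 1 to expose three factors of known sign. *)
      replace ((D c - s * K * E c) * exp (- (s * K * c)) * z) with
        (- ((K * E c - s * D c) * (s * z) * exp (- (s * K * c))))
        by (destruct Hs as [-> | ->]; ring).
      assert (0 <= K * E c - s * D c) by (destruct Hs as [-> | ->]; lra).
      assert (0 <= (K * E c - s * D c) * (s * z) * exp (- (s * K * c))).
      { apply Rmult_le_pos; [now apply Rmult_le_pos|lra]. }
      lra. }
    nra.
Qed.

Lemma pow_sub_lower_bound (m x y : R) (k : nat) : 0 < m -> m <= y <= x ->
  m ^ k * (x - y) <= x ^ S k - y ^ S k.
Proof.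
  intros Hm H; induction k as [|k IH]; [simpl; lra|].
  replace (x ^ S (S k) - y ^ S (S k)) with
    (x * (x ^ S k - y ^ S k) + y ^ S k * (x - y)) by (simpl; ring).
  assert (m ^ S k <= y ^ S k) by (apply pow_incr; lra).
  assert (0 <= m ^ k * (x - y)) by (apply Rmult_le_pos; [apply pow_le|]; lra).
  assert (0 <= x * (x ^ S k - y ^ S k)) by (apply Rmult_le_pos; lra).
  nra.
Qed.

(** This makes v a Lipschitz function of v^n away from 0. Equal signs are essential, since x and -x
    share their even powers; a negative pair reduces to a positive one by factoring out
    (-1)^(k+1). *)
Lemma pow_sub_abs_lower_bound (m x y : R) (k : nat) : 0 < m ->
  m <= Rabs x -> m <= Rabs y -> 0 < x * y ->
  m ^ k * Rabs (x - y) <= Rabs (x ^ S k - y ^ S k).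
Proof.
  intros Hm.
  assert (Hpos : forall x y, m <= x -> m <= y ->
    m ^ k * Rabs (x - y) <= Rabs (x ^ S k - y ^ S k)).
  { intros x0 y0 Hx Hy; destruct (Rle_dec y0 x0).
    - rewrite (Rabs_pos_eq (x0 - y0)) by lra.
      eapply Rle_trans; [|apply Rle_abs]; apply pow_sub_lower_bound; lra.
    - rewrite Rabs_minus_sym, (Rabs_minus_sym (x0 ^ S k)).
      rewrite (Rabs_pos_eq (y0 - x0)) by lra.
      eapply Rle_trans; [|apply Rle_abs]; apply pow_sub_lower_bound; lra. }
  intros Hx Hy Hxy; destruct (Rle_dec 0 x).
  - assert (0 < y) by nra.
    rewrite (Rabs_pos_eq x) in Hx by lra; rewrite (Rabs_pos_eq y) in Hy by lra.
    auto.
  - assert (y < 0) by nra.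
    rewrite (Rabs_left x) in Hx by lra; rewrite (Rabs_left y) in Hy by lra.
    assert (H' := Hpos (- x) (- y) Hx Hy).
    replace (- x - - y) with (- (x - y)) in H' by ring.
    replace ((- x) ^ S k - (- y) ^ S k) with ((-1) ^ S k * (x ^ S k - y ^ S k)) in H'.
    2:{ replace (- x) with (-1 * x) by ring; replace (- y) with (-1 * y) by ring.
        rewrite !Rpow_mult_distr; ring. }
    rewrite Rabs_mult, pow_1_abs, Rabs_Ropp, Rmult_1_l in H'; exact H'.
Qed.

Lemma continuous_nonvanishing_sign (f : R -> R) (r z : R) :
  (forall x, Rabs x < r -> continuity_pt f x) ->
  (forall x, Rabs x < r -> f x <> 0) -> Rabs z < r -> 0 < f 0 * f z.
Proof.
  intros Hc Hn Hz.
  destruct (Rlt_dec 0 (f 0 * f z)) as [|Hneg]; [assumption|exfalso].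
  assert (Hin : forall t, 0 <= t <= 1 -> Rabs (t * z) < r).
  { intros t Ht; rewrite Rabs_mult, (Rabs_pos_eq t) by lra.
    assert (H := Rabs_pos z); nra. }
  assert (H0 : Rabs (0 * z) < r) by (apply Hin; lra).
  assert (H0' := Hn _ H0); rewrite Rmult_0_l in H0'.
  assert (Hz' := Hn z Hz).
  assert (Hsq : 0 < f 0 * f 0) by nra.
  assert (f 0 * f z <> 0) by now apply Rmult_integral_contrapositive_currified.
  (* The parameter t on [0, 1] handles both signs of z, and the outer minus sign makes the function
     go from negative to positive. *)
  destruct (Ranalysis5.IVT_interv (fun t => - (f 0 * f (t * z))) 0 1) as [t [Ht E]].
  - intros t Ht.
    apply (continuity_pt_opp (fun t => f 0 * f (t * z))).
    apply (continuity_pt_scal (fun t => f (t * z))).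
    apply (continuity_pt_comp (fun t => t * z) f); [|now apply Hc, Hin].
    apply derivable_continuous_pt; reg.
  - lra.
  - rewrite Rmult_0_l; lra.
  - rewrite Rmult_1_l; lra.
  - apply (Hn _ (Hin t Ht)).
    assert (E' : f 0 * f (t * z) = 0) by lra.
    apply Rmult_integral in E'; tauto.
Qed.

Lemma continuous_nonvanishing_bound (f : R -> R) (Z : R) : 0 <= Z ->
  (forall x, Rabs x <= Z -> continuity_pt f x) ->
  (forall x, Rabs x <= Z -> f x <> 0) ->
  exists m, 0 < m /\ forall x, Rabs x <= Z -> m <= Rabs (f x).
Proof.
  intros HZ Hc Hn.
  destruct (continuity_ab_min (fun x => Rabs (f x)) (- Z) Z) as [x0 [Hmin Hx0]].
  - lra.
  - intros x Hx; apply (continuity_pt_comp f Rabs).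
    + apply Hc, Rabs_le; lra.
    + apply Rcontinuity_abs.
  - exists (Rabs (f x0)); split.
    + apply Rabs_pos_lt, Hn, Rabs_le; lra.
    + intros x Hx; apply Hmin; now apply Rabs_le_between.
Qed.

(** For a fixed z all estimates live on [-Z, Z] with Z = |z|. Since Z < [delta] and [delta <= d],
    the factor x^2 - d^2 stays away from 0 there. *)
Lemma solution_unique (n : nat) (d lambda u0 u01 delta : R) (v1 v2 : R -> R) :
  (0 < n)%nat -> 0 < d -> delta <= d ->
  nowhere_vanishing_solution n d lambda u0 u01 delta v1 ->
  nowhere_vanishing_solution n d lambda u0 u01 delta v2 ->
  forall z, - delta < z < delta -> v1 z = v2 z.
Proof.
  intros Hn Hd Hdelta S1 S2 z Hz.
  assert (HZ : Rabs z < delta) by (apply Rabs_lt_between; lra).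
  set (Z := Rabs z) in *.
  assert (HZ0 : 0 <= Z) by apply Rabs_pos.
  assert (Hint : forall x, Rabs x < delta -> - delta < x < delta)
    by (intros x Hx; now apply Rabs_lt_between).
  assert (Hcont : forall v, nowhere_vanishing_solution n d lambda u0 u01 delta v ->
     forall x, Rabs x < delta -> continuity_pt v x).
  { intros v S x Hx; apply derivable_continuous_pt, ex_derive_Reals_0.
    now apply (sol_diff _ _ _ _ _ _ _ S), Hint. }
  assert (Hne : forall v, nowhere_vanishing_solution n d lambda u0 u01 delta v ->
     forall x, Rabs x < delta -> v x <> 0).
  { intros v S x Hx; now apply (sol_neq0 _ _ _ _ _ _ _ S), Hint. }
  assert (Hmin : forall v, nowhere_vanishing_solution n d lambda u0 u01 delta v ->
     exists m, 0 < m /\ forall x, Rabs x <= Z -> m <= Rabs (v x)).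
  { intros v S; apply continuous_nonvanishing_bound; [exact HZ0| |];
      intros x Hx; [apply (Hcont v S)|apply (Hne v S)]; lra. }
  destruct (Hmin v1 S1) as [m1 [Hm1 Hv1]], (Hmin v2 S2) as [m2 [Hm2 Hv2]].
  set (m := Rmin m1 m2).
  assert (Hm : 0 < m) by now apply Rmin_glb_lt.
  assert (Hmm1 : m <= m1) by apply Rmin_l.
  assert (Hmm2 : m <= m2) by apply Rmin_r.
  (* Both solutions keep the sign of their common initial value [u0]. *)
  assert (Hsign : forall x, Rabs x <= Z -> 0 < v1 x * v2 x).
  { intros x Hx.
    assert (P1 := continuous_nonvanishing_sign v1 delta x (Hcont v1 S1) (Hne v1 S1)
                    ltac:(lra)).
    assert (P2 := continuous_nonvanishing_sign v2 delta x (Hcont v2 S2) (Hne v2 S2)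
                    ltac:(lra)).
    rewrite (sol_init _ _ _ _ _ _ _ S1) in P1.
    rewrite (sol_init _ _ _ _ _ _ _ S2) in P2.
    assert (P := Rmult_lt_0_compat _ _ P1 P2).
    assert (0 <= u0 * u0) by apply Rle_0_sqr.
    nra. }
  set (w1 := fun x => v1 x ^ n); set (w2 := fun x => v2 x ^ n).
  set (W1 := fun x => (x ^ 2 - d ^ 2) * Derive w1 x).
  set (W2 := fun x => (x ^ 2 - d ^ 2) * Derive w2 x).
  (* [A] is the Lipschitz constant of w' in terms of W, and [B] that of v in terms of w. *)
  set (A := / (d ^ 2 - Z ^ 2)); set (B := / m ^ (n - 1)).
  assert (HdZ : 0 < d ^ 2 - Z ^ 2) by (simpl; nra).
  assert (HA : 0 < A) by now apply Rinv_0_lt_compat.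
  assert (HB : 0 < B) by now apply Rinv_0_lt_compat, pow_lt.
  assert (HL : 0 <= Rabs lambda) by apply Rabs_pos.
  assert (Hw : forall v, nowhere_vanishing_solution n d lambda u0 u01 delta v ->
    forall x, Rabs x <= Z -> is_derive (fun y => v y ^ n) x (Derive (fun y => v y ^ n) x)).
  { intros v S x Hx; apply Derive_correct, (ex_derive_pow v n).
    apply (sol_diff _ _ _ _ _ _ _ S), Hint; lra. }
  assert (HvW : forall x, Rabs x <= Z -> Rabs (v1 x - v2 x) <= B * Rabs (w1 x - w2 x)).
  { intros x Hx.
    assert (P := pow_sub_abs_lower_bound m (v1 x) (v2 x) (n - 1) Hm
       ltac:(specialize (Hv1 x Hx); lra) ltac:(specialize (Hv2 x Hx); lra) (Hsign x Hx)).
    replace (S (n - 1)) with n in P by lia.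
    fold (w1 x) (w2 x) in P.
    assert (Hmp : 0 < m ^ (n - 1)) by now apply pow_lt.
    apply (Rmult_le_reg_l (m ^ (n - 1))); [exact Hmp|].
    rewrite <- Rmult_assoc; unfold B; rewrite Rinv_r, Rmult_1_l by lra.
    exact P. }
  assert (HwW : forall x, Rabs x <= Z ->
    Rabs (Derive w1 x - Derive w2 x) <= A * Rabs (W1 x - W2 x)).
  { intros x Hx.
    assert (Hx2 : x ^ 2 <= Z ^ 2) by (rewrite <- (pow2_abs x); apply pow_incr; split; [apply Rabs_pos|lra]).
    unfold W1, W2; rewrite <- Rmult_minus_distr_l, Rabs_mult, Rabs_minus_sym, (Rabs_left (x ^ 2 - d ^ 2)) by lra.
    assert (HP := Rabs_pos (Derive w2 x - Derive w1 x)).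
    apply (Rmult_le_reg_l (d ^ 2 - Z ^ 2)); [lra|].
    rewrite <- Rmult_assoc; unfold A; rewrite Rinv_r, Rmult_1_l by lra.
    apply Rmult_le_compat_r; lra. }
  assert (HE : (w1 z - w2 z) ^ 2 + (W1 z - W2 z) ^ 2 <= 0).
  { apply (gronwall_0 (fun x => (w1 x - w2 x) ^ 2 + (W1 x - W2 x) ^ 2)
      (fun x => 2 * (w1 x - w2 x) * (Derive w1 x - Derive w2 x) +
                2 * (W1 x - W2 x) * (lambda * v1 x - lambda * v2 x))
      (A + Rabs lambda * B) Z).
    - intros x Hx.
      assert (D1 := Hw v1 S1 x Hx); assert (D2 := Hw v2 S2 x Hx).
      assert (F1 := sol_eq _ _ _ _ _ _ _ S1 x (Hint x ltac:(lra))).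
      assert (F2 := sol_eq _ _ _ _ _ _ _ S2 x (Hint x ltac:(lra))).
      fold w1 in D1, F1; fold w2 in D2, F2; fold W1 in F1; fold W2 in F2.
      assert (G1 := is_derive_pow _ 2 x _ (is_derive_minus _ _ x _ _ D1 D2)).
      assert (G2 := is_derive_pow _ 2 x _ (is_derive_minus _ _ x _ _ F1 F2)).
      assert (G := is_derive_plus _ _ x _ _ G1 G2).
      eapply is_derive_eq_value; [|exact G].
      unfold minus, plus, opp, W1, W2, w1, w2; simpl; ring.
    - intros x Hx.
      assert (P1 := HvW x Hx); assert (P2 := HwW x Hx).
      eapply Rle_trans; [apply Rabs_triang|].
      rewrite <- Rmult_minus_distr_l, !Rabs_mult, (Rabs_pos_eq 2) by lra.
      rewrite <- (pow2_abs (w1 x - w2 x)), <- (pow2_abs (W1 x - W2 x)).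
      assert (Q1 := Rabs_pos (w1 x - w2 x)); assert (Q2 := Rabs_pos (W1 x - W2 x)).
      set (p := Rabs (w1 x - w2 x)) in *; set (q := Rabs (W1 x - W2 x)) in *.
      (* The cross terms are absorbed by 2 p q <= p^2 + q^2, which explains the constant
         [A + Rabs lambda * B]. *)
      apply Rle_trans with (2 * p * (A * q) + 2 * q * (Rabs lambda * (B * p))).
      + apply Rplus_le_compat; apply Rmult_le_compat_l; try lra; nra.
      + replace (2 * p * (A * q) + 2 * q * (Rabs lambda * (B * p)))
          with ((A + Rabs lambda * B) * (2 * p * q)) by ring.
        apply Rmult_le_compat_l.
        * assert (0 <= Rabs lambda * B) by (apply Rmult_le_pos; lra); lra.
        * assert (0 <= (p - q) ^ 2) by apply pow2_ge_0; simpl in *; lra.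
    (* At 0 both w and w' are determined by [u0] and [u01], so w and W agree there. *)
    - assert (I1 := is_derive_unique _ _ _ (is_derive_pow _ n 0 _ (sol_init1 _ _ _ _ _ _ _ S1))).
      assert (I2 := is_derive_unique _ _ _ (is_derive_pow _ n 0 _ (sol_init1 _ _ _ _ _ _ _ S2))).
      unfold W1, W2, w1, w2; rewrite I1, I2.
      rewrite (sol_init _ _ _ _ _ _ _ S1), (sol_init _ _ _ _ _ _ _ S2); ring.
    - unfold Z; lra. }
  assert (Hw0 : w1 z - w2 z = 0).
  { assert (H1 := pow2_ge_0 (w1 z - w2 z)); assert (H2 := pow2_ge_0 (W1 z - W2 z)).
    apply Rsqr_0_uniq; unfold Rsqr; simpl in *; lra. }
  assert (Hv := HvW z ltac:(unfold Z; lra)).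
  rewrite Hw0, Rabs_R0, Rmult_0_r in Hv.
  destruct (Req_dec (v1 z - v2 z) 0) as [E|E]; [lra|].
  apply Rabs_pos_lt in E; lra.
Qed.

(** * Construction of the solution and its Taylor coefficients *)

Theorem mainTheorem3 (n : nat) (delta' lambda u0 u01 : R)
    (hn : (1 < n)%nat) (hdelta' : 0 < delta') (hlambda : lambda <> 0)
    (hu0 : u0 <> 0) :
  exists delta2 : R, 0 < delta2 /\
  exists u : R -> R,
    nowhere_vanishing_solution n delta' lambda u0 u01 delta2 u /\
    (forall v : R -> R,
       nowhere_vanishing_solution n delta' lambda u0 u01 delta2 v ->
       forall z, - delta2 < z < delta2 -> v z = u z) /\
    analytic_on delta2 u /\
    (forall (i : nat) (z : R), - delta2 < z < delta2 -> ex_derive_n u i z) /\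
    let a := taylor_coeff u in
    let b := power_coeff a n in
    (forall z, - delta2 < z < delta2 -> is_pseries a z (u z)) /\
    (forall i : nat,
       a (i + 2)%nat =
       - (lambda * a i /
          (delta' ^ 2 * (INR i + 1) * (INR i + 2) * INR n * a 0%nat ^ (n - 1)))
       + 1 / (delta' ^ 2 * (INR i + 2) * INR n * a 0%nat ^ n) *
         (sum_n_m (fun k => (INR k * (INR n + 1) - INR i) *
                            a k * b (i - k)%nat) 1 i
          - delta' ^ 2 *
            sum_n_m (fun k => (INR k * (INR n + 1) - INR i - 2) *
                              a k * b (i + 2 - k)%nat) 1 (i + 1))).
Proof.
  assert (Hd : delta' <> 0) by lra.
  assert (Hn : (0 < n)%nat) by lia.
  destruct (recurrence_solvable n delta' lambda u0 u01) as [a [Ha0 [Ha1 Hrec]]].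
  assert (Ha : a 0%nat <> 0) by now rewrite Ha0.
  set (b := power_coeff a n).
  assert (H1 := fun j => power_coeff_log_derivative a n j Ha).
  assert (H2 := fun i => recurrence_ode n delta' lambda a i Hn Hd Ha (Hrec i)).
  fold b in H1, H2.
  assert (Hb0 : b 0%nat <> 0) by now apply pow_nonzero.
  destruct (coeff_geometric_bound n delta' lambda a b Hn hdelta' Hb0 H1 H2)
    as [rho [M [Hrho HM]]].
  assert (CVa : forall z, Rabs z < rho -> Rbar_lt (Rabs z) (CV_radius a)).
  { intros z; apply geometric_bound_CV_radius with M; intros k; apply HM. }
  assert (CVb : forall z, Rabs z < rho -> Rbar_lt (Rabs z) (CV_radius b)).
  { intros z; apply geometric_bound_CV_radius with M; intros k; apply HM. }
  assert (CV0 : Rbar_lt 0 (CV_radius a)).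
  { rewrite <- Rabs_R0; apply CVa; now rewrite Rabs_R0. }
  destruct (PSeries_neq0_near0 a CV0 Ha) as [r1 [Hr1 Hne]].
  (* [delta'] serves uniqueness, [rho] the convergence of both series, and [r1] the absence of
     zeros. *)
  set (delta := Rmin delta' (Rmin rho r1)).
  assert (Hdelta : 0 < delta) by (unfold delta; repeat apply Rmin_glb_lt; lra).
  assert (Hdrho : delta <= rho)
    by (eapply Rle_trans; [apply Rmin_r|apply Rmin_l]).
  assert (Hdr : delta <= r1)
    by (eapply Rle_trans; [apply Rmin_r|apply Rmin_r]).
  assert (Hdd : delta <= delta') by apply Rmin_l.
  assert (Hint : forall z, - delta < z < delta -> Rabs z < delta)
    by (intros z Hz; now apply Rabs_lt_between).
  set (u := PSeries a).
  assert (Hpow : forall z, Rabs z < delta -> u z ^ n = PSeries b z).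
  { intros z Hz; apply (power_identity n rho a b CVa CVb delta z); auto.
    - intros x Hx; now apply (PSeries_log_derivative n rho a b CVa CVb).
    - intros x Hx; apply Hne; lra. }
  assert (Hsol : nowhere_vanishing_solution n delta' lambda u0 u01 delta u).
  { split.
    - intros z Hz; apply Hne; specialize (Hint z Hz); lra.
    - intros z Hz; apply ex_derive_PSeries, CVa; specialize (Hint z Hz); lra.
    - intros z Hz.
      (* The identity u^n = w holds on an open interval, so it passes to the inner derivative near z
         and the series form of the equation applies. *)
      apply is_derive_ext_loc with
        (fun y => (y ^ 2 - delta' ^ 2) * PSeries (PS_derive b) y).
      + assert (Hopen : open (fun y => - delta < y < delta))
          by (apply open_and; [apply open_gt|apply open_lt]).
        apply (filter_imp (fun y => - delta < y < delta)); [|now apply Hopen].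
        intros y Hy; f_equal.
        rewrite <- Derive_PSeries by (apply CVb; specialize (Hint y Hy); lra).
        apply Derive_ext_loc.
        apply (filter_imp (fun y => - delta < y < delta)); [|now apply Hopen].
        intros x Hx; symmetry; now apply Hpow, Hint.
      + apply (PSeries_ode delta' lambda rho a b CVb z H2).
        specialize (Hint z Hz); lra.
    - now rewrite <- Ha0; apply PSeries_0.
    - apply is_derive_eq_value with (PSeries (PS_derive a) 0).
      + rewrite PSeries_0, <- Ha1; unfold PS_derive; simpl; ring.
      + apply is_derive_PSeries; now rewrite Rabs_R0. }
  (* The coefficients produced by the recursion are the Taylor coefficients of u, so the recurrence
     transfers to the latter. *)
  assert (Htaylor : forall i, taylor_coeff u i = a i).
  { intros i; unfold taylor_coeff, u; rewrite Derive_n_coef by exact CV0.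
    field; apply INR_fact_neq_0. }
  exists delta; split; [exact Hdelta|].
  exists u; split; [exact Hsol|split; [|split; [|split; [|split]]]].
  - intros v Hv; now apply (solution_unique n delta' lambda u0 u01 delta v u).
  - intros z0 Hz0; assert (Hz0' := Hint z0 Hz0).
    destruct (PSeries_recenter a rho z0 CVa) as [c Hc].
    (* Positive because |z0| < [delta] <= [rho]. *)
    exists (rho - Rabs z0), c; split; [lra|exact Hc].
  - intros i z Hz; apply ex_derive_n_PSeries, CVa; specialize (Hint z Hz); lra.
  - intros z Hz; apply is_pseries_ext with a; [intros; symmetry; apply Htaylor|].
    apply PSeries_correct, CV_radius_inside, CVa; specialize (Hint z Hz); lra.
  - intros i; rewrite Htaylor, Hrec.
    apply (recurrence_rhs_ext n delta' lambda a (taylor_coeff u)).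
    intros k _; symmetry; apply Htaylor.
Qed.
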